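(* Let $\beta>0$, let $H_n$ be the generalized $\beta$-Hermite ensemble and $H_n^w$ the generalized spiked $\beta$-Hermite ensemble (with spike sequence $(\mu_n)$ and parameter $w\in\mathbb R$), as defined in the context, and let $$R_n:=n^{1/6}(2\sqrt n\,I_n-H_n),\qquad R_n^w:=n^{1/6}(2\sqrt n\,I_n-H_n^w).$$ Then one can define tridiagonal matrices $Q_n$ (together with a decomposition of their entries into potential and noise terms) such that, with $m_n=n^{1/3}$ and $w_n=\mu_n/\sqrt n$: (a) $R_n=-\Delta_n+Q_n$, and hypotheses (1)–(7) of the context hold; (b) in the spiked case, $R_n^w=-\Delta_n^w+Q_n$, and hypotheses (1)–(9) of the context hold; and in both cases the Brownian motion $W=\tfrac12(W^D+W^U+W^L)$ has variance $1/\beta$ and the limiting potential is $V(x)=\tfrac12(V^D(x)+V^U(x)+V^L(x))=x/2$.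
   Context: Notation. $\mathbb R_+=[0,\infty)$, $\mathbb N_0=\{0,1,2,\dots\}$. Entries of $(n+1)\times(n+1)$ matrices are indexed by $0\le a,b\le n$; $I_n$ is the $(n+1)\times(n+1)$ identity. Given positive $(m_n)$ and real $(w_n)$: $\Delta_n$ is $m_n^2$ times the $(n+1)\times(n+1)$ tridiagonal matrix with $-2$ on the diagonal and $1$ on the super- and sub-diagonals, and $\Delta_n^w:=\Delta_n+\mathrm{diag}(m_n^2w_n,0,\dots,0)$. $Q_n$ is the tridiagonal matrix with $Q_n(a,a)=D_n(a)$ $(0\le a\le n)$, $Q_n(a,a+1)=U_n(a)$, $Q_n(a+1,a)=L_n(a)$ $(0\le a\le n-1)$, real random variables with $E_n(a)=V_n^E(a)+\xi_n^E(a)$, $E\in\{D,U,L\}$, where $V_n^E(a)$ is deterministic and $\xi_n^E(a)$ is random. Statements for $0\le a\le n$ are understood for $0\le a\le n-1$ when $E=U,L$, and $\xi_n^E(a)=0$ outside the index range. Hypotheses: (1) There are $0<C\le1$ and $1/13<\mathfrak d<1/2$ with $Cn^{\mathfrak d}\le m_n\le C^{-1}n^{\mathfrak d}$ for all $n$. (2) There are nonnegative continuous $V^D,V^U,V^L:\mathbb R_+\to\mathbb R$ such that $V_n^E(\lfloor m_nx\rfloor)\to V^E(x)$ uniformly on compact subsets of $\mathbb R_+$ for each $E$; and $V:=\tfrac12(V^D+V^U+V^L)$ satisfies $V(x)/\log x\to\infty$ as $x\to\infty$. (3) For every $E$: for large enough $n$, $0\le V_n^E(a)\le 2m_n^2$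 for $0\le a\le n$; and if $C_n=o(n)$ then $\max_{a\le C_n}V_n^E(a)=o(m_n^2)$. (4) At least one $E\in\{D,U,L\}$ satisfies: for every $\theta>0$ there are $c>0$, $N\in\mathbb N$ such that for all $n\ge N$, $\theta\log(1+a/m_n)-c\le V^E_n(a)\le m_n^2$ for $0\le a\le n$. Moreover at least one $E$ (not necessarily the same) satisfies: there are $\alpha$ with $\frac{\mathfrak d}{2(1-\mathfrak d)}<\alpha\le\frac{2\mathfrak d}{1-\mathfrak d}$, $\varepsilon>0$, and $\kappa,C>0$ with $\kappa(a/m_n)^\alpha\le V_n^E(a)\le m_n^2$ for $Cn^{1-\varepsilon}\le a\le n$ and $n$ large enough. (5) For every $n$ and each $E$, the variables $\xi_n^E(a)$ (over all admissible $a$) are independent. (The vectors $\xi_n^D,\xi_n^U,\xi_n^L$ need not be independent of each other.) (6) For every $E$: $|\mathbf E[\xi_n^E(a)]|=o(m_{n-a}^{-1/2})$ as $(n-a)\to\infty$, and there are $C>0$ and $0<\gamma<2/3$ with $\mathbf E[|\xi_n^E(a)|^q]\le m_n^{q/2}C^qq^{\gamma q}$ for every $0\le a\le n$, $q\in\mathbb N$ and $n$ large enough. (7) There are Brownian motions $W^D,W^U,W^L$ such that $\big(\frac1{m_n}\sum_{a=0}^{\lfloor m_nx\rfloor}\xi_n^E(a)\big)_{E=D,U,L}\to(W^E(x))_{E=D,U,L}$, $x\ge0$, in joint distribution in the Skorokhod topology; $W:=\tfrac12(W^D+W^U+W^L)$ is a Brownian motion with some variance $\sigma^2>0$; and if $\varphi_1,\dots,\varphi_k$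 are continuous and compactly supported and $\varphi_i^{(n)}\to\varphi_i$ uniformly for each $i$, then $\big(\sum_{a\in\mathbb N_0}\varphi_i^{(n)}(a/m_n)\frac{\xi_n^E(a)}{m_n}\big)_{E,\,i}\to\big(\int_{\mathbb R_+}\varphi_i\,dW^E\big)_{E,\,i}$ in joint distribution, jointly also with the preceding convergence. (8) $m_n(1-w_n)\to w$ for some $w\in\mathbb R$. (9) $(D_n(0)/m_n^{1/2})_n$ is uniformly sub-Gaussian. A sequence $(X_n)$ is uniformly sub-Gaussian if there are $C,c>0$ with $\sup_n\mathbf E[e^{y|X_n|}]\le Ce^{cy^2}$ for all $y\ge0$. Generalized $\beta$-Hermite ensemble. Let $\xi_n^D\in\mathbb R^{n+1}$ and $\xi_n^U=\xi_n^L\in\mathbb R^n$ be random vectors satisfying (5), (6), (7) with $m_n=n^{1/3}$, and let $\beta>0$ be such that $W=\tfrac12(W^D+W^U+W^L)$ has variance $1/\beta$. Let $\chi_n(a):=\sqrt{n-a}-\xi_n^U(a)/n^{1/6}$. $H_n$ is the symmetric $(n+1)\times(n+1)$ tridiagonal matrix with $H_n(a,a)=-\xi_n^D(a)/n^{1/6}$ $(0\le a\le n)$ and $H_n(a,a+1)=H_n(a+1,a)=\chi_n(a)$ $(0\le a\le n-1)$. Generalized spiked $\beta$-Hermite ensemble. Let $(\mu_n)$ be real numbers with $\lim_{n\to\infty}n^{-1/6}(\sqrt n-\mu_n)=w\in\mathbb R$. Let $\xi_n^D\in\mathbb R^{n+1}$ and $\xi_n^U=\xi_n^L\in\mathbb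 R^n$ be random vectors satisfying (5), (6), (7) with $m_n=n^{1/3}$ and such that $W=\tfrac12(W^D+W^U+W^L)$ has variance $1/\beta$, and let $H_n$ be the generalized $\beta$-Hermite ensemble built from these vectors, i.e. the symmetric $(n+1)\times(n+1)$ tridiagonal matrix with $H_n(a,a)=-\xi_n^D(a)/n^{1/6}$ $(0\le a\le n)$ and $H_n(a,a+1)=H_n(a+1,a)=\sqrt{n-a}-\xi_n^U(a)/n^{1/6}$ $(0\le a\le n-1)$. Assuming further that $(\xi_n^D(0)/n^{1/6})_n$ is uniformly sub-Gaussian, $H_n^w:=H_n+\mathrm{diag}(\mu_n,0,\dots,0)$.
   Formalization: In hypothesis (7), the functions φ_i^(n) converging uniformly to φ_i are required to be supported in one common compact set; without this, (7) contradicts itself (φ=0, φ^(n)=K_n^{-1/4}·1_[0,K_n] with K_n→∞ slowly). *)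

(* Defs.v *)
From HB Require Import structures.
From mathcomp Require Import all_boot all_order all_algebra.
From mathcomp Require Import all_classical all_reals all_analysis.

Set Implicit Arguments.
Unset Strict Implicit.
Unset Printing Implicit Defensive.
Import Order.TTheory GRing.Theory Num.Theory.
Import numFieldNormedType.Exports.
Local Open Scope classical_set_scope.
Local Open Scope ring_scope.

(* Time runs over [0, +oo[, but paths are total functions on [R]; nothing below
   depends on their values at negative times (so the topology on [cadlag R]
   identifies paths that agree on [0, +oo[). *)
Definition is_cadlag {R : realType} (x : R -> R) : Prop :=
  (forall t, 0 <= t -> x @ t^'+ --> x t) /\
  (forall t, 0 < t -> cvg (x @ t^'-)).

Record cadlag (R : realType) := Cadlag {
  path :> R -> R;
  path_cadlag : is_cadlag path }.

Definition time_change {R : realType} (l : R -> R) : Prop :=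
  set_bij `[0, +oo[ `[0, +oo[ l /\
  {in `[0, +oo[ &, {homo l : s t / s < t}}.

(* The sets [J1_ball x K e] form a neighbourhood basis at [x] of the Skorokhod
   J1 topology on [0, +oo[: [y n] converges to [x] for the resulting topology
   iff there are time changes [l n] with [l n t - t --> 0] uniformly in [t >= 0]
   and [y n (l n t) - x t --> 0] uniformly on [0, K] for every [K] (Jacod and
   Shiryaev, Limit Theorems for Stochastic Processes, Theorem VI.1.14). *)
Definition J1_ball {R : realType} (x : cadlag R) (K e : R) : set (cadlag R) :=
  [set y | exists2 l, time_change l &
    (forall t, 0 <= t -> `|l t - t| < e) /\
    (forall t, 0 <= t <= K -> `|y (l t) - x t| < e)].

Definition J1_nbhs {R : realType} (x : cadlag R) : set_system (cadlag R) :=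
  [set A | exists K e, 0 < e /\ J1_ball x K e `<=` A].

Lemma time_change_id (R : realType) : time_change (@id R).
Proof. by split=> [|//]; split=> // t t0; exists t. Qed.

Lemma time_change_ge0 (R : realType) (l : R -> R) (t : R) :
  time_change l -> 0 <= t -> 0 <= l t.
Proof.
move=> [[lfun _ _] _] t0.
have /lfun : `[0, +oo[%classic t by rewrite /= in_itv/= t0.
by rewrite /= in_itv/= andbT.
Qed.

Lemma time_change_comp (R : realType) (l k : R -> R) :
  time_change l -> time_change k -> time_change (k \o l).
Proof.
move=> tl tk; split; first exact: set_bij_comp tl.1 tk.1.
move=> s t; rewrite !in_itv/= !andbT => s0 t0 st.
by apply: tk.2; rewrite ?in_itv/= ?andbT ?(time_change_ge0 tl)//;
  apply: tl.2; rewrite ?in_itv/= ?andbT.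
Qed.

Lemma J1_ball_center (R : realType) (x : cadlag R) (K e : R) :
  0 < e -> J1_ball x K e x.
Proof.
move=> e0; exists id; first exact: time_change_id.
by split => t _; rewrite subrr normr0.
Qed.

Lemma J1_ballS (R : realType) (x : cadlag R) (K K' e e' : R) :
  K' <= K -> e <= e' -> J1_ball x K e `<=` J1_ball x K' e'.
Proof.
move=> KK ee y [l tl [l1 l2]]; exists l => //; split => t ht.
  exact: lt_le_trans (l1 _ ht) ee.
apply: lt_le_trans (l2 _ _) ee; case/andP: ht => -> /= tK.
exact: le_trans tK KK.
Qed.

Lemma J1_nbhs_filter (R : realType) (x : cadlag R) : ProperFilter (J1_nbhs x).
Proof.
apply: Build_ProperFilter => [[K [e [e0 /(_ x)]]]|].
  by apply; exact: J1_ball_center.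
split.
- by exists 0, 1; split.
- move=> A B [K [e [e0 KA]]] [K' [e' [e'0 KB]]].
  exists (Num.max K K'), (Num.min e e'); rewrite lt_min e0 e'0; split=> // y yb.
  split; [apply: KA|apply: KB]; apply: J1_ballS yb;
    by rewrite ?le_max ?ge_min lexx ?orbT.
- by move=> A B AB [K [e [e0 KA]]]; exists K, e; split => // y /KA /AB.
Qed.

Lemma J1_nbhs_singleton (R : realType) (x : cadlag R) (A : set (cadlag R)) :
  J1_nbhs x A -> A x.
Proof. by move=> [K [e [e0]]]; apply; exact: J1_ball_center. Qed.

Lemma J1_nbhs_nbhs (R : realType) (x : cadlag R) (A : set (cadlag R)) :
  J1_nbhs x A -> J1_nbhs x (J1_nbhs^~ A).
Proof.
move=> [K [e [e0 KA]]]; have e20 : 0 < e / 2 by rewrite divr_gt0.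
exists K, (e / 2); split => // y [l tl [l1 l2]].
exists (K + e / 2), (e / 2); split => // z [k tk [k1 k2]]; apply: KA.
exists (k \o l); first exact: time_change_comp.
split => t ht /=.
  rewrite -(subrKA (l t)) (le_lt_trans (ler_normD _ _))// (splitr e) ltrD ?l1//.
  by apply: k1; exact: (time_change_ge0 tl).
rewrite -(subrKA (y (l t))) (le_lt_trans (ler_normD _ _))// (splitr e).
rewrite ltrD ?l2//; apply: k2; case/andP: ht => t0 tK.
rewrite (time_change_ge0 tl)//= -lerBlDr; apply: le_trans tK.
by have := l1 _ t0; rewrite ltr_distlC => /andP[/ltW].

Qed.

HB.instance Definition _ (R : realType) := gen_eqMixin (cadlag R).
HB.instance Definition _ (R : realType) := gen_choiceMixin (cadlag R).
HB.instance Definition _ (R : realType) := hasNbhs.Build (cadlag R) J1_nbhs.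
HB.instance Definition _ (R : realType) :=
  Nbhs_isNbhsTopological.Build (cadlag R)
    (@J1_nbhs_filter R) (@J1_nbhs_singleton R) (@J1_nbhs_nbhs R).

Lemma floor_path_cadlag (R : realType) (m : R) (g : nat -> R) :
  is_cadlag (fun t => g (Num.truncn (m * t))).
Proof.
have m_le0 t : m <= 0 -> 0 <= t -> Num.truncn (m * t) = 0%N.
  move=> m0 t0; apply/eqP; rewrite -leqn0 truncn_le_nat.
  by rewrite (le_lt_trans _ ltr01)// mulr_le0_ge0.
split=> t t0.
  have [m0|m0] := leP m 0.
    rewrite m_le0//; apply: cvg_near_cst; near=> x.
    by rewrite m_le0// (le_trans t0)//; near: x; exact: nbhs_right_ge.
  apply: cvg_near_cst; near=> x; congr g.
  have tx : t <= x by near: x; exact: nbhs_right_ge.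
  have x0 : 0 <= x by exact: le_trans tx.
  apply/eqP; rewrite truncn_eq ?(mulr_ge0 (ltW m0) x0)//; apply/andP; split.
    apply: (@le_trans _ _ (m * t)); last by rewrite ler_pM2l.
    by rewrite truncn_le (mulr_ge0 (ltW m0)).
  rewrite mulrC -ltr_pdivlMr//; near: x; apply: nbhs_right_lt.
  by rewrite ltr_pdivlMr// mulrC truncnS_gt.
have [m0|m0] := leP m 0.
  apply/cvg_ex; exists (g 0%N); apply: cvg_near_cst; near=> x.
  by rewrite m_le0//; near: x; exact: nbhs_left_ge.
have mt0 : 0 < m * t by rewrite mulr_gt0.
have [j /andP[jt tj]] : exists j : nat, j%:R < m * t <= j.+1%:R.
  have := truncn_itv (ltW mt0); set k := Num.truncn _ => /andP[].
  rewrite le_eqVlt => /orP[/eqP kt _|k1 /ltW k2]; last by exists k; rewrite k1.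
  case: k kt => [kt|k kt]; first by move: mt0; rewrite -kt ltxx.
  by exists k; rewrite -kt lexx ltr_nat ltnSn.
apply/cvg_ex; exists (g j); apply: cvg_near_cst; near=> x; congr g.
have x0 : 0 <= x by near: x; exact: nbhs_left_ge.
apply/eqP; rewrite truncn_eq ?(mulr_ge0 (ltW m0) x0)//; apply/andP; split.
  rewrite mulrC -ler_pdivrMr//; near: x; apply: nbhs_left_ge.
  by rewrite ltr_pdivrMr// mulrC.
apply: lt_le_trans tj; rewrite ltr_pM2l//; near: x; exact: nbhs_left_lt.
Unshelve. all: by end_near. Qed.

Definition floor_path {R : realType} (m : R) (g : nat -> R) : cadlag R :=
  Cadlag (floor_path_cadlag m g).

(* Convergence in distribution; the [X n] may live on different probability
   spaces. *)
Definition cvg_in_law {R : realType} {S : topologicalType}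
    {d : nat -> measure_display} {T : forall n, measurableType (d n)}
    (P : forall n, probability (T n) R) (X : forall n, T n -> S)
    {d' : measure_display} {T' : measurableType d'}
    (P' : probability T' R) (Y : T' -> S) : Prop :=
  forall f : S -> R, continuous f -> bounded_fun f ->
    ('E_(P n)[f \o X n])%E @[n --> \oo] --> ('E_P'[f \o Y])%E.

(* Subfamilies are covered by taking [B i = setT]. *)
Definition mutually_independent {R : realType} {d : measure_display}
    {T : measurableType d} (P : probability T R) (N : nat)
    (X : nat -> T -> R) : Prop :=
  forall B : nat -> set R, (forall i, measurable (B i)) ->
    P (\bigcap_(i in `I_N) (X i @^-1` B i)) =
    (\prod_(i < N) P (X i @^-1` B i))%E.

(* Brownian motion of variance [v], i.e. [W t] has variance [v * t]; the second
   argument of [normal_prob] is the standard deviation. *)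
Definition is_brownian {R : realType} {d : measure_display}
    {T : measurableType d} (P : probability T R) (v : R)
    (W : T -> R -> R) : Prop :=
  [/\ forall t, 0 <= t -> measurable_fun setT (W ^~ t),
      forall w, W w 0 = 0 /\ {within `[0, +oo[, continuous (W w)},
      forall s t, 0 <= s < t -> forall B : set R, measurable B ->
        P ((fun w => W w t - W w s) @^-1` B) =
        normal_prob 0 (Num.sqrt (v * (t - s))) B
    & forall (N : nat) (t : nat -> R),
        0 <= t 0%N -> (forall i, t i <= t i.+1) ->
        mutually_independent P N (fun i w => W w (t i.+1) - W w (t i))].

(* A list of triples [(c, (a, b))] encodes the step function equal to the sum
   of the [c * \1_[a, b[]. *)
Definition step_fun {R : realType} (s : seq (R * (R * R))) (x : R) : R :=
  \sum_(p <- s) p.1 * \1_(`[p.2.1, p.2.2[) x.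

Definition step_integral {R : realType} (s : seq (R * (R * R)))
    (W : R -> R) : R :=
  \sum_(p <- s) p.1 * (W p.2.2 - W p.2.1).

(* [J] is (a version of) the Wiener integral of the deterministic function
   [phi] over [0, +oo[ with respect to [W]: the L^2(P)-limit of the integrals of
   step functions that converge to [phi] in L^2([0, +oo[). *)
Definition is_wiener_integral {R : realType} {d : measure_display}
    {T : measurableType d} (P : probability T R) (W : T -> R -> R)
    (phi : R -> R) (J : {RV P >-> R}) : Prop :=
  exists s : nat -> seq (R * (R * R)),
    [/\ forall N p, p \in s N -> 0 <= p.2.1 <= p.2.2,
        (\int[lebesgue_measure]_(x in `[0%R, +oo[)
           ((phi x - step_fun (s N) x) ^+ 2)%:E)%E @[N --> \oo] --> 0%E
      & ('E_P[fun w => ((J w - step_integral (s N) (W w)) ^+ 2)%R])%E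
          @[N --> \oo] --> 0%E].

Definition uniformly_subgaussian {R : realType} {d : nat -> measure_display}
    {T : forall n, measurableType (d n)} (P : forall n, probability (T n) R)
    (X : forall n, T n -> R) : Prop :=
  exists C c : R, [/\ 0 < C, 0 < c & forall n (y : R), (0 < n)%N -> 0 <= y ->
    ('E_(P n)[fun w => expR (y * `|X n w|)%R] <= (C * expR (c * y ^+ 2))%:E)%E].

(* Sequences are indexed from [n = 1]; below, quantifications over all [n]
   are restricted to [0 < n], and values at [n = 0] are irrelevant. *)

Definition tridiag {R : realType} (n : nat) (dg up lo : nat -> R) :
    'M[R]_n.+1 :=
  \matrix_(i, j)
    if i == j :> nat then dg i
    else if j == i.+1 :> nat then up i
    else if i == j.+1 :> nat then lo j
    else 0.

(* diag(c, 0, ..., 0) *)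
Definition corner {R : realType} (n : nat) (c : R) : 'M[R]_n.+1 :=
  c *: delta_mx ord0 ord0.

Definition laplacian {R : realType} (m : nat -> R) (n : nat) : 'M[R]_n.+1 :=
  m n ^+ 2 *: tridiag n (fun=> -2) (fun=> 1) (fun=> 1).

Definition laplacian_w {R : realType} (m w : nat -> R) (n : nat) :
    'M[R]_n.+1 :=
  laplacian m n + corner n (m n ^+ 2 * w n).

(* Indices of the diagonal, superdiagonal and subdiagonal entries. *)
Inductive entry := ED | EU | EL.

Definition entry_size (E : entry) (n : nat) : nat :=
  if E is ED then n.+1 else n.

Definition noise {R : realType} {d : nat -> measure_display}
    {T : forall n, measurableType (d n)} (P : forall n, probability (T n) R) :=
  entry -> forall n, nat -> {RV (P n) >-> R}.

Definition noise_supported {R : realType} {d : nat -> measure_display}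
    {T : forall n, measurableType (d n)} {P : forall n, probability (T n) R}
    (xi : noise P) : Prop :=
  forall E n a w, (entry_size E n <= a)%N -> xi E n a w = 0.

Definition potential_noise_mx {R : realType} {d : nat -> measure_display}
    {T : forall n, measurableType (d n)} {P : forall n, probability (T n) R}
    (V : entry -> nat -> nat -> R) (xi : noise P) (n : nat) (w : T n) :
    'M[R]_n.+1 :=
  let e E a := V E n a + xi E n a w in tridiag n (e ED) (e EU) (e EL).

Definition mesh_growth {R : realType} (m : nat -> R) (dd : R) : Prop :=
  13^-1 < dd < 2^-1 /\
  exists C : R, 0 < C <= 1 /\ forall n, (0 < n)%N ->
    C * n%:R `^ dd <= m n <= C^-1 * n%:R `^ dd.

Definition potential_limit {R : realType} (m : nat -> R)
    (V : entry -> nat -> nat -> R) (Vlim : entry -> R -> R) : Prop :=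
  (forall E, [/\ forall x, 0 <= x -> 0 <= Vlim E x,
      {within `[0, +oo[, continuous (Vlim E)}
    & forall K : set R, compact K -> K `<=` `[0, +oo[ ->
        {uniform K, (fun n x => V E n (Num.truncn (m n * x))) @ \oo
          --> Vlim E}]) /\
  (Vlim ED x + Vlim EU x + Vlim EL x) / 2 / ln x @[x --> +oo] --> +oo.

Definition potential_bounds {R : realType} (m : nat -> R)
    (V : entry -> nat -> nat -> R) : Prop :=
  forall E,
    (\forall n \near \oo, forall a, (a < entry_size E n)%N ->
       0 <= V E n a <= 2 * m n ^+ 2) /\
    (forall C : nat -> R, C =o_\oo (fun n => n%:R : R) ->
       (fun n => \big[Num.max/0]_(a < entry_size E n | a%:R <= C n) V E n a)
         =o_\oo (fun n => m n ^+ 2)).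

Definition potential_growth {R : realType} (m : nat -> R) (dd : R)
    (V : entry -> nat -> nat -> R) : Prop :=
  (exists E, forall theta : R, 0 < theta -> exists c : R, 0 < c /\
     \forall n \near \oo, forall a, (a < entry_size E n)%N ->
       theta * ln (1 + a%:R / m n) - c <= V E n a <= m n ^+ 2) /\
  (exists (E : entry) (alpha eps kappa C : R),
     [/\ dd / (2 * (1 - dd)) < alpha <= 2 * dd / (1 - dd),
         0 < eps, 0 < kappa, 0 < C &
     \forall n \near \oo, forall a, (a < entry_size E n)%N ->
       C * n%:R `^ (1 - eps) <= a%:R ->
       kappa * (a%:R / m n) `^ alpha <= V E n a <= m n ^+ 2]).

Definition noise_independent {R : realType} {d : nat -> measure_display}
    {T : forall n, measurableType (d n)} {P : forall n, probability (T n) R}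
    (xi : noise P) : Prop :=
  forall E n, (0 < n)%N -> mutually_independent (P n) (entry_size E n) (xi E n).

Definition noise_moments {R : realType} {d : nat -> measure_display}
    {T : forall n, measurableType (d n)} {P : forall n, probability (T n) R}
    (m : nat -> R) (xi : noise P) : Prop :=
  forall E,
    (forall e : R, 0 < e -> exists N : nat, forall n a,
       (a < entry_size E n)%N -> (N <= n - a)%N ->
       (`| 'E_(P n)[xi E n a] | <= (e * m (n - a)%N `^ (- 2^-1))%:E)%E) /\
    (exists C g : R, [/\ 0 < C, 0 < g < 2 / 3 &
       \forall n \near \oo, forall a q, (a < entry_size E n)%N -> (0 < q)%N ->
         ('E_(P n)[fun w => (`|xi E n a w| ^+ q)%R] <=
           (m n `^ (q%:R / 2) * C ^+ q * q%:R `^ (g * q%:R))%:E)%E]).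

Definition noise_path {R : realType} {d : nat -> measure_display}
    {T : forall n, measurableType (d n)} {P : forall n, probability (T n) R}
    (m : nat -> R) (xi : noise P) (n : nat) (w : T n) (E : entry) : cadlag R :=
  floor_path (m n) (fun k => (m n)^-1 * \sum_(0 <= a < k.+1) xi E n a w).

(* The noise converges to Brownian motions whose half-sum has variance [v].
   In the last clause, the [phin n i] are supported in a common compact set and
   converge uniformly to [phi i]. Without a common support the clause would
   contradict the first convergence: for [phi = 0] and
   [phin n = e n * \1_[0, k n]] the sum is [e n * noise_path m xi n w E (k n)],
   which is not tight if [k n] grows slowly and [e n = k n `^ (-1/4)]. *)
Definition noise_limit {R : realType} {d : nat -> measure_display}
    {T : forall n, measurableType (d n)} {P : forall n, probability (T n) R}
    (m : nat -> R) (xi : noise P) (v : R) : Prop :=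
  exists (d' : measure_display) (T' : measurableType d')
      (P' : probability T' R) (W : T' -> entry -> cadlag R),
  [/\ forall E, exists2 vE, 0 < vE & is_brownian P' vE (fun w => W w E : R -> R),
      0 < v,
      is_brownian P' v (fun w t => (W w ED t + W w EU t + W w EL t) / 2),
      cvg_in_law P
        (fun n w => noise_path m xi w : {ptws entry -> cadlag R})
        P' W
    & forall (k : nat) (phi : 'I_k -> R -> R) (phin : nat -> 'I_k -> R -> R)
        (K : R),
      (forall i, {within `[0, +oo[, continuous (phi i)}) ->
      (forall i x, K < x -> phi i x = 0) ->
      (forall n i x, K < x -> phin n i x = 0) ->
      (forall i, {uniform `[0, +oo[, (phin ^~ i) @ \oo --> phi i}) ->
      exists J : entry -> 'I_k -> {RV P' >-> R},
        (forall E i,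
           is_wiener_integral (fun w => W w E : R -> R) (phi i) (J E i)) /\
        cvg_in_law P
          (fun n w => (noise_path m xi w,
             fun E i => \sum_(0 <= a < n.+1)
               phin n i (a%:R / m n) * (xi E n a w / m n))
           : {ptws entry -> cadlag R} * {ptws entry -> {ptws 'I_k -> R}})
          P' (fun w => (W w, fun E i => J E i w))].

Definition spike_limit {R : realType} (m w : nat -> R) (wlim : R) : Prop :=
  m n * (1 - w n) @[n --> \oo] --> wlim.

(* All hypotheses on the unspiked model, with limiting potentials [Vlim] and
   with [v] the variance of the limiting Brownian motion. *)
Definition model_hypotheses {R : realType} {d : nat -> measure_display}
    {T : forall n, measurableType (d n)} {P : forall n, probability (T n) R}
    (m : nat -> R) (V : entry -> nat -> nat -> R) (xi : noise P)
    (Vlim : entry -> R -> R) (v : R) : Prop :=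
  exists dd,
    [/\ mesh_growth m dd, potential_limit m V Vlim, potential_bounds m V,
        potential_growth m dd V &
    [/\ noise_independent xi, noise_moments m xi & noise_limit m xi v]].

Definition cbrt_mesh {R : realType} (n : nat) : R := n%:R `^ 3^-1.

Definition hermite_noise {R : realType} {d : nat -> measure_display}
    {T : forall n, measurableType (d n)} {P : forall n, probability (T n) R}
    (beta : R) (xi : noise P) : Prop :=
  [/\ noise_supported xi, forall n a w, xi EU n a w = xi EL n a w &
  [/\ noise_independent xi, noise_moments cbrt_mesh xi
    & noise_limit cbrt_mesh xi beta^-1]].

Definition hermite_mx {R : realType} {d : nat -> measure_display}
    {T : forall n, measurableType (d n)} {P : forall n, probability (T n) R}
    (xi : noise P) (n : nat) (w : T n) : 'M[R]_n.+1 :=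
  let chi a := Num.sqrt (n%:R - a%:R) - xi EU n a w / n%:R `^ 6^-1 in
  tridiag n (fun a => - xi ED n a w / n%:R `^ 6^-1) chi chi.

Definition spiked_hermite_mx {R : realType} {d : nat -> measure_display}
    {T : forall n, measurableType (d n)} {P : forall n, probability (T n) R}
    (xi : noise P) (mu : nat -> R) (n : nat) (w : T n) : 'M[R]_n.+1 :=
  hermite_mx xi w + corner n (mu n).

Definition edge_scaling {R : realType} (n : nat) (H : 'M[R]_n.+1) :
    'M[R]_n.+1 :=
  n%:R `^ 6^-1 *: ((2 * Num.sqrt n%:R)%:M - H).

Definition spiked_hypotheses {R : realType} {d : nat -> measure_display}
    {T : forall n, measurableType (d n)} {P : forall n, probability (T n) R}
    (xi : noise P) (mu : nat -> R) (wlim : R) : Prop :=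
  n%:R `^ (- 6^-1) * (Num.sqrt n%:R - mu n) @[n --> \oo] --> wlim /\
  uniformly_subgaussian P (fun n w => xi ED n 0%N w / n%:R `^ 6^-1).

(* Main.v *)
Require Import Defs.
From HB Require Import structures.
From mathcomp Require Import all_boot all_order all_algebra.
From mathcomp Require Import all_classical all_reals all_analysis.
From mathcomp Require Import ring lra.

Set Implicit Arguments.
Unset Strict Implicit.
Unset Printing Implicit Defensive.
Import Order.TTheory GRing.Theory Num.Theory.
Import numFieldNormedType.Exports.
Local Open Scope classical_set_scope.
Local Open Scope ring_scope.

(** The whole content of the theorem is that the scaled matrix splits as
    [- laplacian + (potential + noise)] with an explicit potential whose noise
    is the given one, so that the hypotheses on the noise are inherited.

    Write [m = n^(1/3)]. As [n^(1/6) * sqrt n = m^2], the diagonal of the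
    scaled matrix is [2 m^2 + xi^D], and its off-diagonal entries are
    [- n^(1/6) sqrt (n - a) + xi^U = - m^2 sqrt (1 - a / n) + xi^U].
    Subtracting those of [- laplacian], namely [2 m^2] and [- m^2], leaves the
    potential [V^D = 0] and [V^U = V^L = m^2 (1 - sqrt (1 - a / n))].

    Everything about this potential follows from
    [u / 2 <= 1 - sqrt (1 - u) <= u / 2 * (1 + u)] for [0 <= u <= 1]
    ([one_sub_sqrt_bounds]): with [u = a / n] and [m^3 = n] it gives
    [y / 2 <= V^U(a) <= y / 2 * (1 + a / n)] for [y = a / m]
    ([hermite_potential_bounds]). On bounded ranges of [y] the quotient [a / n]
    tends to [0], hence the limit [x / 2] for both off-diagonal potentials, and
    for the half-sum of the three. The lower bound is linear in [y], which
    dominates every [theta * ln (1 + y)], and gives the polynomial growth with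
    exponent [alpha = 1], the largest one allowed when [dd = 1/3]. The upper
    bound gives [V^U(a) <= m^2 * (a / n)], hence [o(m^2)] for [a = o(n)].

    The spike [mu] contributes the corner entry
    [- n^(1/6) mu = - m^2 * (mu / sqrt n)], so [w_n = mu / sqrt n], and
    [m (1 - w_n) = n^(-1/6) (sqrt n - mu)] is the quantity assumed to
    converge. Since [V^D = 0] the corner of potential plus noise is [xi^D(0)], so
    the sub-Gaussian hypothesis is the given one. *)

(** * Powers of the dimension *)

Section powers.
Context {R : realType}.
Implicit Types n : nat.

Lemma cbrt_mesh_gt0 n : (0 < n)%N -> 0 < cbrt_mesh n :> R.
Proof. by move=> n0; rewrite powR_gt0// ltr0n. Qed.

Lemma cbrt_mesh_sqrM n : cbrt_mesh n ^+ 2 * cbrt_mesh n = n%:R :> R.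
Proof.
by rewrite -exprSr /cbrt_mesh -powR_mulrn ?powR_ge0// -powRrM mulVf// powRr1.
Qed.

Lemma root6_sqr n : (n%:R `^ 6^-1) ^+ 2 = cbrt_mesh n :> R.
Proof.
by rewrite -powR_mulrn ?powR_ge0// -powRrM; congr (_ `^ _); lra.
Qed.

Lemma sqrt_cbrt_mesh n : cbrt_mesh n `^ 2^-1 = n%:R `^ 6^-1 :> R.
Proof. by rewrite /cbrt_mesh -powRrM; congr (_ `^ _); lra. Qed.

Lemma root6_sqrt n : n%:R `^ 6^-1 * Num.sqrt n%:R = cbrt_mesh n ^+ 2 :> R.
Proof.
rewrite -powR12_sqrt// -root6_sqr -exprM -powR_mulrn ?powR_ge0// -powRrM.
case: n => [|n]; first by rewrite !powR0 ?mul0r//; apply/eqP; lra.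
by rewrite -powRD; [congr (_ `^ _); lra | rewrite pnatr_eq0 implybT].
Qed.

Lemma root6_sqrt_sub n a : (0 < n)%N -> (a <= n)%N ->
  n%:R `^ 6^-1 * Num.sqrt (n%:R - a%:R) =
  cbrt_mesh n ^+ 2 * Num.sqrt (1 - a%:R / n%:R) :> R.
Proof.
move=> n0 an; rewrite -root6_sqrt -mulrA -sqrtrM ?ler0n// mulrBr mulr1.
by rewrite [n%:R * _]mulrC divfK// pnatr_eq0 -lt0n.
Qed.

(** For [w = mu / sqrt n], the quantity [m * (1 - w)] of the spike condition is
    the one that converges by assumption on [mu]. *)
Lemma cbrt_mesh_spike n (mu : R) : (0 < n)%N ->
  cbrt_mesh n * (1 - mu / Num.sqrt n%:R) =
  n%:R `^ (- 6^-1) * (Num.sqrt n%:R - mu).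
Proof.
move=> n0.
have h0 : n%:R `^ 6^-1 != 0 :> R by rewrite gt_eqF// powR_gt0// ltr0n.
have s0 : Num.sqrt n%:R != 0 :> R by rewrite gt_eqF// sqrtr_gt0 ltr0n.
have := root6_sqrt n; rewrite powRN -root6_sqr.
set h := _ `^ _ in h0 *; set s := Num.sqrt _ in s0 * => hs.
have -> : s = h ^+ 3 by apply: (mulfI h0); rewrite hs; ring.
by field.
Qed.

Lemma cbrt_mesh_dvg : cbrt_mesh n @[n --> \oo] --> (+oo : set_system R).
Proof.
apply/cvgryPge => A; near=> n.
have nA : `|A| ^+ 3 <= n%:R by near: n; exact: nbhs_infty_ger.
apply: le_trans (ler_norm A) _.
rewrite -(@ler_pXn2r _ 3) ?nnegrE ?powR_ge0//.
by rewrite [leRHS]exprSr cbrt_mesh_sqrM.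
Unshelve. all: by end_near. Qed.

Lemma mesh_growth_cbrt : mesh_growth (@cbrt_mesh R) 3^-1.
Proof.
split; first lra.
by exists 1; split => [|n n0]; [lra | rewrite invr1 mul1r lexx].
Qed.

End powers.

(** * The potential of the Hermite matrices *)

Section potential.
Context {R : realType}.

(** For [a <= n] the off-diagonal value is [n^(1/6) (sqrt n - sqrt (n - a))];
    this form depends on [a] through the ratio [a / n] only. *)
Definition hermite_potential (E : entry) (n a : nat) : R :=
  if E is ED then 0
  else cbrt_mesh n ^+ 2 * (1 - Num.sqrt (1 - a%:R / n%:R)).

(** Each off-diagonal contributes [x / 2], so the half-sum over the three
    entries is the potential [x / 2] of the stochastic Airy operator. *)
Definition airy_potential (E : entry) (x : R) : R :=
  if E is ED then 0 else x / 2.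

(** With [r = sqrt (1 - u)], the lower bound is [(1 - r)^2 >= 0] and the upper
    one is [(1 - r)^2 * r * (r + 2) >= 0]. *)
Lemma one_sub_sqrt_bounds (u : R) : 0 <= u <= 1 ->
  u / 2 <= 1 - Num.sqrt (1 - u) <= u / 2 * (1 + u).
Proof.
move=> /andP[u0 u1].
have r0 : 0 <= Num.sqrt (1 - u) by exact: sqrtr_ge0.
have rE : Num.sqrt (1 - u) ^+ 2 = 1 - u by rewrite sqr_sqrtr// subr_ge0.
have -> : u = 1 - Num.sqrt (1 - u) ^+ 2 by rewrite rE; ring.
move: r0 rE; set r := Num.sqrt _ => r0 rE.
have -> : Num.sqrt (1 - (1 - r ^+ 2)) = r.
  by rewrite opprB addrC subrK sqrtr_sqr ger0_norm.
have := mulr_ge0 (mulr_ge0 (sqr_ge0 (1 - r)) r0) (addr_ge0 r0 (ler0n _ 2)).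
have := sqr_ge0 (1 - r).
by move=> lower upper; apply/andP; split; lra.
Qed.

(** [m^2 * (a / n) / 2 = a / (2 * m)], as [m^3 = n]. *)
Lemma hermite_potential_bounds E n a : E <> ED -> (0 < n)%N -> (a <= n)%N ->
  a%:R / (2 * cbrt_mesh n) <= hermite_potential E n a <=
    a%:R / (2 * cbrt_mesh n) * (1 + a%:R / n%:R).
Proof.
move=> EnD n0 an.
have n0R : 0 < n%:R :> R by rewrite ltr0n.
have m0 := @cbrt_mesh_gt0 R _ n0.
have /one_sub_sqrt_bounds/andP[lb ub] : 0 <= (a%:R / n%:R : R) <= 1.
  by rewrite divr_ge0//= ler_pdivrMr// mul1r ler_nat.
have -> : hermite_potential E n a =
    cbrt_mesh n ^+ 2 * (1 - Num.sqrt (1 - a%:R / n%:R)) by case: E EnD.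
have -> : a%:R / (2 * cbrt_mesh n) = cbrt_mesh n ^+ 2 * (a%:R / n%:R / 2) :> R.
  by rewrite -(@cbrt_mesh_sqrM R n); field; rewrite gt_eqF.
by rewrite /= -(mulrA (cbrt_mesh n ^+ 2)) !ler_pM2l ?exprn_gt0// lb.
Qed.

Lemma hermite_potential_ge0 E n a : 0 <= hermite_potential E n a.
Proof.
case: E => //=; rewrite mulr_ge0 ?sqr_ge0// subr_ge0 -[leRHS]sqrtr1;
by rewrite ler_wsqrtr// gerBl divr_ge0.
Qed.

Lemma hermite_potential_le_ratio E n a : (0 < n)%N -> (a <= n)%N ->
  hermite_potential E n a <= cbrt_mesh n ^+ 2 * (a%:R / n%:R).
Proof.
move=> n0 an; have u0 : 0 <= (a%:R / n%:R : R) by rewrite divr_ge0.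
have u1 : (a%:R / n%:R : R) <= 1.
  by rewrite ler_pdivrMr ?ltr0n// mul1r ler_nat.
have /andP[_ ub] : _ := one_sub_sqrt_bounds (introT andP (conj u0 u1)).
case: E => /=; first by rewrite mulr_ge0 ?sqr_ge0.
all: rewrite ler_wpM2l ?sqr_ge0// (le_trans ub)//; nra.
Qed.

Lemma hermite_potential_le E n a : (0 < n)%N -> (a <= n)%N ->
  hermite_potential E n a <= cbrt_mesh n ^+ 2.
Proof.
move=> n0 an; apply: le_trans (hermite_potential_le_ratio E n0 an) _.
rewrite -[leRHS]mulr1 ler_wpM2l ?sqr_ge0//.
by rewrite ler_pdivrMr ?ltr0n// mul1r ler_nat.
Qed.

(** If [a <= C n] and [C n <= e * n] then
    [V n a <= m^2 * (a / n) <= e * m^2]. *)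
Lemma hermite_potential_bounded : potential_bounds cbrt_mesh hermite_potential.
Proof.
have size_le E n a : (a < entry_size E n)%N -> (a <= n)%N.
  by case: E => //=; exact: ltnW.
move=> E; split.
  near=> n => a /size_le an; rewrite hermite_potential_ge0/=.
  rewrite (le_trans (hermite_potential_le E _ an))//; last first.
    by have := sqr_ge0 (cbrt_mesh n : R); lra.
  by near: n; exists 1%N.
move=> C /eqoP oC; apply/eqoP => e e0.
have oCe := oC _ e0.
near=> n.
have n0 : (0 < n)%N by near: n; exists 1%N.
have nR0 : 0 < n%:R :> R by rewrite ltr0n.
have Cn : `|C n| <= e * n%:R by rewrite -[n%:R]ger0_norm//; near: n.
rewrite (ger0_norm (sqr_ge0 _)) ger0_norm; last exact: bigmax_ge_id.
apply: bigmax_le; first by rewrite mulr_ge0 ?sqr_ge0// ltW.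
move=> [a /= /size_le an] aC.
apply: le_trans (hermite_potential_le_ratio E n0 an) _.
rewrite mulrC ler_wpM2r ?sqr_ge0// ler_pdivrMr//.
by apply: le_trans aC _; apply: le_trans (ler_norm _) Cn.
Unshelve. all: by end_near. Qed.

(** The logarithm lies below its tangent at [2 * theta], which is where
    [theta * ln] has slope [1 / 2]. *)
Lemma ln1D_le_half (theta y : R) : 0 < theta -> 0 <= y ->
  theta * ln (1 + y) <= `|theta * ln (2 * theta)| + 1 + y / 2.
Proof.
move=> t0 y0.
have t20 : 0 < 2 * theta by rewrite mulr_gt0.
have q0 : 0 < (1 + y) / (2 * theta) by rewrite divr_gt0// ltr_wpDr.
have -> : 1 + y = 2 * theta * ((1 + y) / (2 * theta)).
  by rewrite mulrC divfK// gt_eqF.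
rewrite lnM ?posrE// mulrDr.
have : ln ((1 + y) / (2 * theta)) <= (1 + y) / (2 * theta) - 1.
  have := @le_ln1Dx R ((1 + y) / (2 * theta) - 1).
  rewrite addrCA subrr addr0; apply; lra.
move/(ler_wpM2l (ltW t0)).
have -> : theta * ((1 + y) / (2 * theta) - 1) = (1 + y) / 2 - theta.
  by field; rewrite gt_eqF.
have := ler_norm (theta * ln (2 * theta)).
lra.
Qed.

Lemma hermite_potential_growth :
  potential_growth cbrt_mesh 3^-1 hermite_potential.
Proof.
split; exists EU.
  move=> theta t0; exists (`|theta * ln (2 * theta)| + 1); split.
    by rewrite ltr_wpDl.
  near=> n => a /= /ltnW an.
  have n0 : (0 < n)%N by near: n; exists 1%N.
  have m0 := @cbrt_mesh_gt0 R _ n0.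
  have -> := hermite_potential_le EU n0 an; rewrite andbT.
  have /andP[lb _] := @hermite_potential_bounds EU n a ltac:(by []) n0 an.
  apply: le_trans lb; rewrite lerBlDl.
  apply: le_trans (ln1D_le_half t0 _) _; first by rewrite divr_ge0// ltW.
  by rewrite lerD2l invfM; lra.
(* Since [V n a >= a / (2 m)] for all [a <= n], the cutoff
   [C n^(1 - eps)] may be any; [alpha = 1] is the upper end of its range. *)
exists 1, 2^-1, 2^-1, 1; split => //.
  have -> : 1 - 3^-1 = 2 / 3 :> R by lra.
  by rewrite -mulf_div mulfV// mulr1 !invfM invrK; apply/andP; split; lra.
near=> n => a /= /ltnW an _.
have n0 : (0 < n)%N by near: n; exists 1%N.
have m0 := @cbrt_mesh_gt0 R _ n0.
have -> := hermite_potential_le EU n0 an; rewrite andbT.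
have /andP[lb _] := @hermite_potential_bounds EU n a ltac:(by []) n0 an.
apply: le_trans lb; rewrite powRr1 ?divr_ge0 ?(ltW m0)//.
by rewrite invfM; lra.
Unshelve. all: by end_near. Qed.

(** Two errors: rounding [m x] to an integer costs at most [1 / (2 m)], and the
    curvature of the square root at most [M / 2 * (M / m)], because
    [a / n <= M / m^2 <= M / m]. *)
Lemma hermite_potential_airy_dist n (x M : R) : 1 <= cbrt_mesh n :> R ->
    0 <= x <= M -> M <= cbrt_mesh n ^+ 2 ->
  `|hermite_potential EU n (Num.truncn (cbrt_mesh n * x)) - x / 2| <=
    (1 + M ^+ 2) / cbrt_mesh n.
Proof.
move=> m1 /andP[x0 xM] Mm.
have n0 : (0 < n)%N.
  by case: n m1 {Mm} => //; rewrite /cbrt_mesh powR0 ?ler10//; apply/eqP; lra.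
have := @cbrt_mesh_sqrM R n.
set m := cbrt_mesh n in m1 Mm *; set a := Num.truncn _ => mE.
have m0 : 0 < m by lra.
have /andP[alb aub] := truncn_itv (mulr_ge0 (ltW m0) x0).
rewrite -/a -natr1 in alb aub.
have an : (a <= n)%N.
  rewrite -(ler_nat R) (le_trans alb)// -mE mulrC ler_pM2r//.
  exact: le_trans Mm.
have /andP[] := @hermite_potential_bounds EU n a ltac:(by []) n0 an.
rewrite -/m; set v := hermite_potential _ _ _ => lb ub.
have y0 : 0 <= a%:R / m by rewrite divr_ge0// ltW.
have yub : a%:R / m <= x by rewrite ler_pdivrMr// mulrC.
have ylb : x - m^-1 <= a%:R / m.
  by rewrite ler_pdivlMr// mulrBl mulVf ?gt_eqF//; lra.
have an' : a%:R / n%:R <= M / m :> R.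
  rewrite -mE invfM mulrCA mulrC ler_pM// ?invr_ge0 ?exprn_ge0 ?(ltW m0)//.
    exact: le_trans yub xM.
  by rewrite lef_pV2 ?posrE ?exprn_gt0// -[leLHS]expr1 ler_weXn2l.
have mi0 : 0 < m^-1 by rewrite invr_gt0.
rewrite invfM in lb ub.
rewrite ler_norml; apply/andP; split.
  have := mulr_ge0 (sqr_ge0 M) (ltW mi0); lra.
have q0 : 0 <= (a%:R / n%:R : R) by rewrite divr_ge0.
have := ler_pM y0 q0 (le_trans yub xM) an'.
lra.
Qed.

(** [ln x = 2 ln (sqrt x) <= 2 sqrt x], so the quotient is at least
    [sqrt x / 4]. *)
Lemma div_ln_dvg : x / 2 / ln x @[x --> +oo] --> (+oo : set_system R).
Proof.
apply/cvgryPge => A; near=> x.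
have x1 : 1 < x by near: x; exact: nbhs_pinfty_gt.
have xA : (4 * `|A|) ^+ 2 <= x by near: x; exact: nbhs_pinfty_ge.
have x0 : 0 < x by lra.
rewrite ler_pdivlMr ?ln_gt0//.
have s0 : 0 < Num.sqrt x by rewrite sqrtr_gt0.
have sE : Num.sqrt x ^+ 2 = x by rewrite sqr_sqrtr// ltW.
have sA : 4 * `|A| <= Num.sqrt x.
  by rewrite -[leLHS]ger0_norm ?mulr_ge0// -sqrtr_sqr ler_wsqrtr.
have lnx : ln x <= 2 * Num.sqrt x.
  rewrite -{1}sE lnXn// mulr_natl lerMn2r/=.
  exact/ltW/ln_sublinear.
have lnx0 : 0 <= ln x by rewrite ln_ge0// ltW.
apply: le_trans (ler_wpM2r lnx0 (ler_norm A)) _.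
apply: le_trans (ler_wpM2l (normr_ge0 A) lnx) _.
have := ler_wpM2r (ltW s0) sA; rewrite -expr2 sE; lra.
Unshelve. all: by end_near. Qed.

Lemma hermite_potential_limit :
  potential_limit cbrt_mesh hermite_potential airy_potential.
Proof.
split; last first.
  rewrite (_ : (fun x => _) = fun x : R => x / 2 / ln x); last first.
    by apply/funext => x /=; congr (_ / _); lra.
  exact: div_ln_dvg.
move=> E; split.
- by move=> x x0; case: E => //=; rewrite divr_ge0.
- apply: continuous_subspaceT => x; case: E; first exact: cvg_cst.
    by apply: cvgM; [exact: cvg_id | exact: cvg_cst].
  by apply: cvgM; [exact: cvg_id | exact: cvg_cst].
move=> K /compact_bounded[M0 [_ KM]] K0.
have {}KM x : K x -> 0 <= x <= `|M0| + 1.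
  move=> Kx; have := K0 x Kx; rewrite /= in_itv/= andbT => x0; rewrite x0/=.
  have M0M : M0 < `|M0| + 1 by rewrite ltr_pwDr ?ler_norm.
  exact: le_trans (ler_norm x) (KM _ M0M x Kx).
set M := `|M0| + 1 in KM.
move=> A /uniform_nbhs[D [entD subA]].
move: entD; rewrite -entourage_ballE => -[e /= e0 eD].
have mesh_ge := (cvgryPge _).1 (@cbrt_mesh_dvg R).
near=> n; apply: subA => x Kx; apply: eD => /=.
have m1 : 1 <= cbrt_mesh n :> R by near: n; exact: mesh_ge.
have mM : M <= cbrt_mesh n by near: n; exact: mesh_ge.
have me : (1 + M ^+ 2) / e + 1 <= cbrt_mesh n by near: n; exact: mesh_ge.
have m0 : 0 < cbrt_mesh n :> R by lra.
have EUE : E <> ED -> hermite_potential E n = hermite_potential EU n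
    /\ airy_potential E = airy_potential EU by case: E.
rewrite /ball/= distrC.
have [->|/EUE[-> ->]] : E = ED \/ E <> ED by case: E {EUE}; [left|right|right].
  by rewrite subrr normr0.
apply: le_lt_trans (hermite_potential_airy_dist m1 (KM _ Kx) _) _.
  by rewrite expr2; nra.
rewrite ltr_pdivrMr// mulrC -ltr_pdivrMr//; lra.
Unshelve. all: by end_near. Qed.

End potential.

(** * The Hermite matrices *)

Section matrices.
Context {R : realType} {d : nat -> measure_display}
  {T : forall n, measurableType (d n)} {P : forall n, probability (T n) R}
  (xi : noise P).

Lemma hermite_model_hypotheses (beta : R) : hermite_noise beta xi ->
  model_hypotheses cbrt_mesh hermite_potential xi airy_potential beta^-1.
Proof.
move=> [_ _ noiseP]; exists 3^-1; split => //.
- exact: mesh_growth_cbrt.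
- exact: hermite_potential_limit.
- exact: hermite_potential_bounded.
- exact: hermite_potential_growth.
Qed.

Lemma edge_scaling_hermite n (w : T n) : (0 < n)%N ->
    (forall a, xi EU n a w = xi EL n a w) ->
  edge_scaling (hermite_mx xi w) =
  - laplacian cbrt_mesh n + potential_noise_mx hermite_potential xi w.
Proof.
move=> n0 xiUL; apply/matrixP => i j.
rewrite !mxE.
have h0 : n%:R `^ 6^-1 != 0 :> R by rewrite gt_eqF// powR_gt0// ltr0n.
have offdiag a : (a <= n)%N -> n%:R `^ 6^-1 *
    (0 - (Num.sqrt (n%:R - a%:R) - xi EU n a w / n%:R `^ 6^-1)) =
    - (cbrt_mesh n ^+ 2 * 1) +
    (cbrt_mesh n ^+ 2 * (1 - Num.sqrt (1 - a%:R / n%:R)) + xi EU n a w) :> R.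
  move=> an; rewrite sub0r opprB mulrBr root6_sqrt_sub//.
  by field.
have [ij|ij] := eqVneq (i : nat) j.
  rewrite (val_inj ij) eqxx mulr1n mulrBr mulrCA root6_sqrt /=; field.
  exact: h0.
have -> : (i == j) = false by apply/negbTE.
rewrite mulr0n; case: ifP => _; first by rewrite offdiag ?leq_ord.
case: ifP => _; first by rewrite offdiag ?leq_ord// xiUL.
by rewrite subrr !mulr0 oppr0 addr0.
Qed.

Lemma edge_scaling_corner n (H : 'M[R]_n.+1) (c : R) :
  edge_scaling (H + corner n c) =
  edge_scaling H - corner n (n%:R `^ 6^-1 * c).
Proof. by rewrite /edge_scaling /corner opprD addrA scalerBr scalerA. Qed.

Lemma potential_noise_mx00 n (w : T n) :
  potential_noise_mx hermite_potential xi w ord0 ord0 = xi ED n 0%N w.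
Proof. by rewrite mxE/= add0r. Qed.

End matrices.

Theorem corollary3p8 (R : realType) (d : nat -> measure_display)
    (T : forall n, measurableType (d n)) (P : forall n, probability (T n) R)
    (beta : R) (xi : noise P) (mu : nat -> R) (wlim : R) :
  0 < beta -> hermite_noise beta xi ->
  exists (Q : forall n, T n -> 'M[R]_n.+1)
    (V : entry -> nat -> nat -> R) (zeta : noise P) (Vlim : entry -> R -> R),
  [/\ (noise_supported zeta /\
       forall n w, Q n w = potential_noise_mx V zeta w),
      ((forall n w, (0 < n)%N ->
          edge_scaling (hermite_mx xi w) = - laplacian cbrt_mesh n + Q n w) /\
       model_hypotheses cbrt_mesh V zeta Vlim beta^-1),
      (spiked_hypotheses xi mu wlim ->
       let w_ n := mu n / Num.sqrt n%:R in
       [/\ forall n w, (0 < n)%N ->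
             edge_scaling (spiked_hermite_mx xi mu w) =
             - laplacian_w cbrt_mesh w_ n + Q n w,
           model_hypotheses cbrt_mesh V zeta Vlim beta^-1,
           spike_limit cbrt_mesh w_ wlim
         & uniformly_subgaussian P
             (fun n w => Q n w ord0 ord0 / cbrt_mesh n `^ 2^-1)])
    & forall x, 0 <= x -> (Vlim ED x + Vlim EU x + Vlim EL x) / 2 = x / 2].
Proof.
move=> _ xiP; have [xi0 xiUL _] := xiP.
have modelP := hermite_model_hypotheses xiP.
exists (fun n => potential_noise_mx hermite_potential xi (n := n)).
exists hermite_potential, xi, airy_potential; split => //.
- by split => // n w n0; apply: edge_scaling_hermite.
- move=> [muP subg]; split => //.
  + move=> n w n0; rewrite /spiked_hermite_mx edge_scaling_corner.
    rewrite edge_scaling_hermite// /laplacian_w opprD addrAC.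
    congr (_ - corner _ _ + _).
    rewrite -root6_sqrt -mulrA [Num.sqrt _ * _]mulrC divfK//.
    by rewrite gt_eqF// sqrtr_gt0 ltr0n.
  + apply: cvg_trans muP; apply: near_eq_cvg; near=> n.
    have n0 : (0 < n)%N by near: n; exists 1%N.
    exact/esym/cbrt_mesh_spike.
  + have [C [c [C0 c0 subP]]] := subg; exists C, c; split => // n y n0 y0.
    under eq_fun do rewrite potential_noise_mx00 sqrt_cbrt_mesh.
    exact: subP.
- by move=> x _ /=; rewrite add0r -splitr.
Unshelve. all: by end_near. Qed.
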